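(* Let $(Z,M,\mu)$ be a measure space with a non-trivial atomless measure $\mu$, and let $1 < a < b \le 2$. Let $\psi:(a,b)\to(0,\infty]$ be a generating function with $\inf_{p\in(a,b)}\psi(p)>0$, and let $G\psi = G\psi[a,b]$ be the associated Grand Lebesgue Space with norm $\|f\|G\psi = \sup_{p\in(a,b)} \|f\|_p/\psi(p)$. For $u\in G\psi$ put $$\kappa[G\psi[a,b]](u) := \inf_{p\in(a,b)} \frac{\|u\|_p^2}{\psi^2(p)}.$$ Then for all $x,y$ in the closed unit ball $B[G\psi[a,b]] = \{f\in G\psi: \|f\|G\psi\le 1\}$, $$\|x+y\|G\psi \le 2 - \frac{a-1}{4}\,\kappa[G\psi[a,b]](x-y).$$
   Context: For a measurable $f:Z\to\mathbb{R}$ and $1\le p<\infty$, $\|f\|_p = \left(\int_Z |f(z)|^p\,\mu(dz)\right)^{1/p}$. Given $1\le a<b\le\infty$ and a function $\psi:(a,b)\to(0,\infty]$ (possibly infinite at some points) with $\inf_{p\in(a,b)}\psi(p)>0$, the Grand Lebesgue Space $G\psi[a,b]$ consists of all real measurable functions $f$ on $Z$ with finite norm $\|f\|G\psi[a,b] := \sup_{p\in(a,b)} \|f\|_p/\psi(p)$, using the convention $C/\infty := 0$. *)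

(* Defs.v *)
From HB Require Import structures.
From mathcomp Require Import all_boot all_order all_algebra.
From mathcomp Require Import all_classical all_reals all_analysis.
Set Implicit Arguments. Unset Strict Implicit. Unset Printing Implicit Defensive.
Import Order.TTheory GRing.Theory Num.Theory.
Local Open Scope classical_set_scope.
Local Open Scope ring_scope.
Local Open Scope ereal_scope.

Definition atomless {d} {T : measurableType d} {R : realType}
  (mu : {measure set T -> \bar R}) : Prop :=
  forall A, measurable A -> 0 < mu A ->
    exists B, [/\ measurable B, B `<=` A, 0 < mu B & mu B < mu A].

(* ||f||_p / psi(p), with the convention C / +oo := 0. *)
Definition Gratio {d} {T : measurableType d} {R : realType}
  (mu : {measure set T -> \bar R}) (psi : R -> \bar R) (f : T -> R) (p : R)
  : \bar R :=
  match psi p with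
  | r%:E => Lnorm mu p%:E (EFin \o f) * (r^-1)%:E
  | _ => 0
  end.

Definition GLnorm {d} {T : measurableType d} {R : realType}
  (mu : {measure set T -> \bar R}) (psi : R -> \bar R) (a b : R) (f : T -> R)
  : \bar R :=
  ereal_sup [set Gratio mu psi f p | p in `]a, b[%classic].

Definition GLspace {d} {T : measurableType d} {R : realType}
  (mu : {measure set T -> \bar R}) (psi : R -> \bar R) (a b : R) (f : T -> R)
  : Prop :=
  measurable_fun [set: T] f /\ GLnorm mu psi a b f < +oo.

Definition GLball {d} {T : measurableType d} {R : realType}
  (mu : {measure set T -> \bar R}) (psi : R -> \bar R) (a b : R) (f : T -> R)
  : Prop :=
  GLspace mu psi a b f /\ GLnorm mu psi a b f <= 1.

Definition Gkappa {d} {T : measurableType d} {R : realType}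
  (mu : {measure set T -> \bar R}) (psi : R -> \bar R) (a b : R) (u : T -> R)
  : \bar R :=
  ereal_inf [set Gratio mu psi u p * Gratio mu psi u p | p in `]a, b[%classic].

(* Main.v *)
Require Import Defs.
From HB Require Import structures.
From mathcomp Require Import all_boot all_order all_algebra.
From mathcomp Require Import all_classical all_reals all_analysis.
From mathcomp Require Import measurable_realfun ring lra.
Import Order.TTheory GRing.Theory Num.Theory.
Import numFieldNormedType.Exports.
Local Open Scope classical_set_scope.
Local Open Scope ring_scope.

(** It suffices to show, for each [p] in [(a, b)] and [x], [y] of [L^p]-norm at
    most [1], that [|x + y|_p^2 + (p - 1) |x - y|_p^2 <= 4]: since
    [s <= 1 + s^2 / 4], this gives [|x + y|_p <= 2 - (p - 1) / 4 * |x - y|_p^2].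
    That inequality is the 2-uniform convexity of [L^p] with its sharp constant
    (Ball, Carlen and Lieb), obtained from the two-point inequality
    [(u^2 + (p - 1) v^2)^(p/2) <= (|u + v|^p + |u - v|^p) / 2] applied pointwise
    to [u = x + y], [v = x - y], and integrated by means of the reverse Minkowski
    inequality in [L^(p/2)]. For [v = t u] with [0 <= t <= 1] both sides of the
    two-point inequality are separated by [1 + p (p - 1) t^2 / 2]. *)

(** * Inequalities between real powers, up to the two-point inequality *)

Section two_point_inequality.
Local Set Implicit Arguments.
Local Unset Strict Implicit.
Context {R : realType}.
Implicit Types (a b f g p q s t x : R).

Lemma ge0_is_derive_le (f df : R -> R) a b : a <= b ->
    (forall x, x \in `[a, b] -> is_derive x 1 f (df x)) ->
    (forall x, x \in `[a, b] -> 0 <= df x) ->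
  f a <= f b.
Proof.
move=> ab fd df0.
have [|c cab fab] := MVT_segment ab (fun x xab => fd x (subset_itv_oo_cc xab)).
  by apply: derivable_within_continuous => x xab; have [] := fd x xab.
by rewrite -subr_ge0 fab mulr_ge0 ?subr_ge0 ?df0.
Qed.

Lemma powR_le1Dmul q x : 0 < q < 1 -> 0 <= x -> (1 + x) `^ q <= 1 + q * x.
Proof.
move=> /andP[q0 q1] x0.
have [q0' q1'] : q != 0 /\ 1 - q != 0 by split; lra.
have := @conjugate_powR R 1 ((1 + x) `^ q) (1 - q)^-1 q^-1.
rewrite !invrK !invr_gt0 subr_gt0 powR_ge0 powR1 mul1r subrK -powRrM mulfV//.
rewrite powRr1; last lra.
move=> /(_ ler01 isT q1 q0 erefl) /le_trans; apply; lra.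
Qed.

Lemma powR_N_sum_ge2 p t : p <= 0 -> -1 < t < 1 ->
  2 <= (1 + t) `^ p + (1 - t) `^ p.
Proof.
move=> p0 /andP[t1 t2].
have [tp tm] : 0 < 1 + t /\ 0 < 1 - t by split; lra.
set u := _ `^ p; set v := (1 - t) `^ p.
have u0 : 0 < u by exact: powR_gt0.
have v0 : 0 < v by exact: powR_gt0.
have uv : 1 <= u * v.
  rewrite /u /v -powRM; [|exact: ltW..].
  rewrite -[leLHS](powRr0 ((1 + t) * (1 - t))).
  by apply: ger_powR => //; rewrite mulr_gt0//=; nra.
by have := sqr_ge0 (u - v); nra.
Qed.

Lemma is_derive_powRDM p c x : 0 < 1 + c * x ->
  is_derive x 1 (fun t => (1 + c * t) `^ p) (p * c * (1 + c * x) `^ (p - 1)).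
Proof.
move=> x0; rewrite mulrAC.
have dg : is_derive x 1 (fun t => 1 + c * t) c.
  by apply: is_derive_eq; rewrite add0r mul1r; exact: mulr1.
exact: (@is_derive1_comp _ (@powR R ^~ p) (fun t => 1 + c * t) x _ _
  (is_derive1_powR p x0) dg).
Qed.

(** The gap between the sides vanishes at 0, and its derivative is nonnegative by [powR_N_sum_ge2]
    with exponent [q - 1]. *)
Lemma powR_diff_ge q t : 0 < q < 1 -> 0 <= t < 1 ->
  2 * q * t <= (1 + t) `^ q - (1 - t) `^ q.
Proof.
move=> /andP[q0 q1] /andP[t0 t1].
pose h s := (1 + 1 * s) `^ q - (1 + (-1) * s) `^ q - 2 * q * s.
pose dh s := q * ((1 + s) `^ (q - 1) + (1 - s) `^ (q - 1) - 2).
have : h 0 <= h t.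
  apply: (@ge0_is_derive_le _ dh) => // s; rewrite in_itv/= => /andP[s0 st].
  - have sp : 0 < 1 + 1 * s by lra.
    have sm : 0 < 1 + -1 * s by lra.
    have := is_deriveB (is_deriveB (is_derive_powRDM q sp)
      (is_derive_powRDM q sm)) (is_deriveZ (2 * q) (is_derive_id s 1)).
    move=> /is_derive_eq; apply; rewrite /dh mul1r mulN1r.
    by rewrite /GRing.scale/=; ring.
  - rewrite mulr_ge0 ?(ltW q0)// subr_ge0 powR_N_sum_ge2//; first lra.
    by apply/andP; split; lra.
rewrite /h !mulr0 !addr0 mul1r mulN1r; lra.
Qed.

(** One more integration of the same kind: the derivative of the gap is [p] times the gap of
    [powR_diff_ge] for [q = p - 1]. Taking [t < 1] keeps [1 - s] positive, where the power is
    differentiable. *)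
Lemma powR_sum_ge_lt1 p t : 1 < p < 2 -> 0 <= t < 1 ->
  2 + p * (p - 1) * t ^+ 2 <= (1 + t) `^ p + (1 - t) `^ p.
Proof.
move=> /andP[p1 p2] /andP[t0 t1].
pose h s := (1 + 1 * s) `^ p + (1 + (-1) * s) `^ p - p * (p - 1) * (s * s).
pose dh s := p * ((1 + s) `^ (p - 1) - (1 - s) `^ (p - 1) - 2 * (p - 1) * s).
have : h 0 <= h t.
  apply: (@ge0_is_derive_le _ dh) => // s; rewrite in_itv/= => /andP[s0 st].
  - have sp : 0 < 1 + 1 * s by lra.
    have sm : 0 < 1 + -1 * s by lra.
    have := is_deriveB (is_deriveD (is_derive_powRDM p sp)
      (is_derive_powRDM p sm))
      (is_deriveZ (p * (p - 1))
        (is_deriveM (is_derive_id s 1) (is_derive_id s 1))).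
    move=> /is_derive_eq; apply; rewrite /dh mul1r mulN1r.
    by rewrite /GRing.scale/=; ring.
  - rewrite mulr_ge0//; first lra.
    by rewrite subr_ge0 powR_diff_ge//; apply/andP; split; lra.
rewrite /h !mulr0 !addr0 mul1r mulN1r !powR1 -expr2; lra.
Qed.

Lemma powR_sum_ge p t : 1 < p < 2 -> 0 <= t <= 1 ->
  2 + p * (p - 1) * t ^+ 2 <= (1 + t) `^ p + (1 - t) `^ p.
Proof.
move=> p12 /andP[t0]; rewrite le_eqVlt => /predU1P[->|t1]; last first.
  by rewrite powR_sum_ge_lt1// t0.
have /andP[p1 p2] := p12.
(* At [t = 1], use the inequality at [1 - e] with [e] small and [e `^ p <= e]. *)
rewrite subrr powR0 ?addr0; last lra.
rewrite leNgt; apply/negP; set c := p * (p - 1); set P := _ `^ p => Pc.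
have [c0 c2] : 0 < c /\ c < 2 by rewrite /c; split; nra.
have P0 : 0 < P by exact: powR_gt0.
pose e := (2 + c - P) / 10.
have [e0 e1] : 0 < e /\ e < 1 by rewrite /e; split; lra.
have eP : 10 * e = 2 + c - P by rewrite /e; field.
have H : 2 + c * (1 - e) ^+ 2 <= (1 + (1 - e)) `^ p + e `^ p.
  rewrite -[X in _ + X `^ _](subKr 1) powR_sum_ge_lt1//.
  by apply/andP; split; lra.
have Hp : (1 + (1 - e)) `^ p <= P.
  by apply: ge0_ler_powR; rewrite ?nnegrE; lra.
have He : e `^ p <= e by apply: ge1r_powR; [rewrite e0 ltW|exact: ltW].
nra.
Qed.

Lemma sqr_powR_half p a : (a ^+ 2) `^ (p / 2) = `|a| `^ p.
Proof.
rewrite -(real_normK (num_real a)) -powR_mulrn// -powRrM.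
by congr (_ `^ _); field.
Qed.

(** By homogeneity, dividing by [a] reduces this to [t = b / a] in [[0, 1]], where [powR_le1Dmul]
    with exponent [p / 2] meets [powR_sum_ge]. *)
Lemma two_point_ge0 p a b : 1 < p < 2 -> 0 <= b <= a ->
  2 * (a ^+ 2 + (p - 1) * b ^+ 2) `^ (p / 2) <= (a + b) `^ p + (a - b) `^ p.
Proof.
move=> p12 /andP[b0 ba]; have /andP[p1 p2] := p12.
have := le_trans b0 ba; rewrite le_eqVlt => /predU1P[a0|a0].
  have -> : b = 0 by apply/eqP; rewrite eq_le b0 -{1}a0 in ba *; rewrite ba.
  rewrite -a0 expr0n mulr0 addr0 powR0; last lra.
  by rewrite mulr0 addr_ge0// powR_ge0.
pose t := b / a.
have bE : b = a * t by rewrite /t mulrC divfK ?gt_eqF.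
have t0 : 0 <= t by rewrite divr_ge0 ?(ltW a0).
have t1 : t <= 1 by rewrite ler_pdivrMr// mul1r.
have -> : a ^+ 2 + (p - 1) * b ^+ 2 = a ^+ 2 * (1 + (p - 1) * t ^+ 2).
  by rewrite bE; ring.
have -> : a + b = a * (1 + t) by rewrite bE; ring.
have -> : a - b = a * (1 - t) by rewrite bE; ring.
have pt0 : 0 <= (p - 1) * t ^+ 2 by rewrite mulr_ge0 ?sqr_ge0//; lra.
rewrite (powRM _ (sqr_ge0 a)); last lra.
rewrite sqr_powR_half (ger0_norm (ltW a0)) !(powRM _ (ltW a0)); [|lra..].
rewrite -mulrDr mulrCA ler_pM2l ?powR_gt0//.
have t01 : 0 <= t <= 1 by rewrite t0.
apply: le_trans (powR_sum_ge p12 t01).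
have p21 : 0 < p / 2 < 1 by apply/andP; split; lra.
have := powR_le1Dmul p21 pt0; lra.
Qed.

Lemma two_point_inequality p a b : 1 < p < 2 ->
  2 * (a ^+ 2 + (p - 1) * b ^+ 2) `^ (p / 2) <= `|a + b| `^ p + `|a - b| `^ p.
Proof.
move=> p12; have /andP[p1 p2] := p12.
(* Sign changes of [a] and [b] at most swap the two terms, so both may be taken nonnegative. *)
have -> : `|a + b| `^ p + `|a - b| `^ p =
    (`|a| + `|b|) `^ p + `| `|a| - `|b| | `^ p.
  wlog a0 : a b / 0 <= a => [h|].
    have [/h//|/ltW a0] := leP 0 a.
    have := h (- a) (- b); rewrite -!opprD !normrN.
    by rewrite oppr_ge0; exact.
  rewrite (ger0_norm a0); have [b0|b0] := leP 0 b.
    by rewrite (ger0_norm b0) (ger0_norm (addr_ge0 a0 b0)).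
  rewrite (ltr0_norm b0) opprK addrC.
  by rewrite (@ger0_norm _ (a - b)) ?addr_ge0// oppr_ge0 ltW.
rewrite -(real_normK (num_real a)) -(real_normK (num_real b)).
move: `|a| `|b| (normr_ge0 a) (normr_ge0 b) => {}a {}b a0 b0.
have [ba|/ltW ab] := leP b a.
  by rewrite ger0_norm ?subr_ge0// two_point_ge0// b0.
(* When [a <= b], exchanging them can only increase the left-hand side, because [p - 1 < 1] and the
   larger square then gets the weight 1. *)
rewrite ler0_norm ?subr_le0// opprB [a + b]addrC.
apply: le_trans (@two_point_ge0 p b a p12 _); last by rewrite a0.
rewrite ler_pM2l//; apply: ge0_ler_powR; rewrite ?nnegrE; [lra|nra|nra|].
have : a ^+ 2 <= b ^+ 2 by rewrite ler_sqr.
nra.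
Qed.

(* Hoelder's inequality for two summands; for [s + t = 1] this is the
   reverse Minkowski inequality in [L^q], linearised. *)
Lemma powRD_ge_weighted q s t f g : 0 < q < 1 ->
    0 <= s -> 0 <= t -> s + t = 1 -> 0 <= f -> 0 <= g ->
  s `^ (1 - q) * f `^ q + t `^ (1 - q) * g `^ q <= (f + g) `^ q.
Proof.
move=> /andP[q0 q1] s0 t0 st f0 g0.
have [q0' q1'] : q != 0 /\ 1 - q != 0 by split; lra.
have := @hoelder2 R (s `^ (1 - q)) (t `^ (1 - q)) (f `^ q) (g `^ q)
  (1 - q)^-1 q^-1.
rewrite !powR_ge0 !invrK !invr_gt0 subrK -!powRrM !mulfV// !powRr1// st.
by rewrite powR1 mul1r; apply=> //; lra.
Qed.

End two_point_inequality.

(** * Uniform convexity of [L^p] for [1 < p < 2] *)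

Section Lp_uniform_convexity.
Local Set Implicit Arguments.
Local Unset Strict Implicit.
Context d (T : measurableType d) (R : realType).
Variable mu : {measure set T -> \bar R}.
Implicit Types (f g : T -> R) (p r : R).

Local Notation "''N_' p [ f ]" := (Lnorm mu p%:E (EFin \o f)).

Lemma integral_powR_Lnorm p f : 0 < p -> ('N_p[f] < +oo)%E ->
  (\int[mu]_x (`|f x| `^ p)%:E = (fine 'N_p[f] `^ p)%:E)%E.
Proof.
move=> p0 foo.
have := powR_Lnorm mu (EFin \o f) (lt0r_neq0 p0).
rewrite -[X in (X `^ _)%E]fineK ?ge0_fin_numE ?Lnorm_ge0// poweR_EFin => ->.
Qed.

Lemma LnormD_lty p f g : 1 <= p ->
    measurable_fun setT f -> measurable_fun setT g ->
    ('N_p[f] < +oo)%E -> ('N_p[g] < +oo)%E ->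
  ('N_p[(f \+ g)%R] < +oo)%E.
Proof.
move=> p1 mf mg foo goo.
by apply: le_lt_trans (minkowski_EFin mu mf mg p1) _; rewrite lte_add_pinfty.
Qed.

Lemma LnormB_lty p f g : 1 <= p ->
    measurable_fun setT f -> measurable_fun setT g ->
    ('N_p[f] < +oo)%E -> ('N_p[g] < +oo)%E ->
  ('N_p[(f \- g)%R] < +oo)%E.
Proof.
move=> p1 mf mg foo goo; apply: (@LnormD_lty p f (\- g)%R) => //.
  exact: measurableT_comp.
by rewrite (_ : EFin \o _ = (\- (EFin \o g))%E)// oppe_Lnorm.
Qed.

Lemma ge0_le_integral_comb2 (c1 c2 c3 c4 : R) (f1 f2 f3 f4 : T -> R) :
    0 <= c1 -> 0 <= c2 -> 0 <= c3 -> 0 <= c4 ->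
    measurable_fun setT f1 -> measurable_fun setT f2 ->
    measurable_fun setT f3 -> measurable_fun setT f4 ->
    (forall x, 0 <= f1 x) -> (forall x, 0 <= f2 x) ->
    (forall x, 0 <= f3 x) -> (forall x, 0 <= f4 x) ->
    (forall x, c1 * f1 x + c2 * f2 x <= c3 * f3 x + c4 * f4 x) ->
  (c1%:E * \int[mu]_x (f1 x)%:E + c2%:E * \int[mu]_x (f2 x)%:E <=
   c3%:E * \int[mu]_x (f3 x)%:E + c4%:E * \int[mu]_x (f4 x)%:E)%E.
Proof.
move=> c10 c20 c30 c40 m1 m2 m3 m4 f10 f20 f30 f40 f1234.
rewrite -!ge0_integralZl_EFin//; do ?by
  [move=> x _; rewrite lee_fin|exact/measurable_EFinP].
rewrite -!ge0_integralD//; do ?by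
  [move=> x _; rewrite -EFinM lee_fin mulr_ge0
  |apply/measurable_EFinP; exact: measurable_funM].
apply: ge0_le_integral => //.
- by move=> x _; rewrite -!EFinM -EFinD lee_fin addr_ge0 ?mulr_ge0.
- apply/measurable_EFinP; apply: measurable_funD; exact: measurable_funM.
- apply/measurable_EFinP; apply: measurable_funD; exact: measurable_funM.
- by move=> x _; rewrite -!EFinM -!EFinD lee_fin.
Qed.

(** The two-point inequality for [u = f + g] and [v = f - g], where [u + v = 2 f] and [u - v = 2 g],
    in integrated form. The integral of the mixed power on its left is never formed: it is replaced
    by linear lower bounds, one for each pair of weights, and the best pair is chosen after
    integration. *)
Lemma Lnorm_parallelogram p f g : 1 < p < 2 ->
    measurable_fun setT f -> measurable_fun setT g ->
    ('N_p[f] < +oo)%E -> ('N_p[g] < +oo)%E ->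
  2 * (fine 'N_p[(f \+ g)%R] ^+ 2 + (p - 1) * fine 'N_p[(f \- g)%R] ^+ 2)
      `^ (p / 2) <=
  2 `^ p * fine 'N_p[f] `^ p + 2 `^ p * fine 'N_p[g] `^ p.
Proof.
move=> p12 mf mg foo goo; have /andP[p1 p2] := p12.
have Doo := LnormD_lty (ltW p1) mf mg foo goo.
have Boo := LnormB_lty (ltW p1) mf mg foo goo.
set S := fine _; set D := fine 'N_p[(f \- g)%R].
have [S0 D0] : 0 <= S /\ 0 <= D by split; rewrite fine_ge0 ?Lnorm_ge0.
have q01 : 0 < p / 2 < 1 by apply/andP; split; lra.
have p0 : 0 < p by lra.
have p10 : 0 <= p - 1 by lra.
have mpow (h : T -> R) : measurable_fun setT h ->
    measurable_fun setT (fun x => `|h x| `^ p).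
  move=> mh; apply: (@measurableT_comp _ _ _ _ _ _ (@powR R ^~ p)) => //.
  exact: measurableT_comp.
(* The weights are constants, so only the integrals of [p]-th powers of [|u|] and [|v|] appear. *)
have weighted s t : 0 <= s -> 0 <= t -> s + t = 1 ->
    2 * s `^ (1 - p / 2) * S `^ p +
    2 * t `^ (1 - p / 2) * (p - 1) `^ (p / 2) * D `^ p <=
    2 `^ p * fine 'N_p[f] `^ p + 2 `^ p * fine 'N_p[g] `^ p.
  move=> s0 t0 st.
  have := @ge0_le_integral_comb2 (2 * s `^ (1 - p / 2))
    (2 * t `^ (1 - p / 2) * (p - 1) `^ (p / 2)) (2 `^ p) (2 `^ p)
    (fun x => `|(f \+ g) x| `^ p) (fun x => `|(f \- g) x| `^ p)
    (fun x => `|f x| `^ p) (fun x => `|g x| `^ p).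
  rewrite !integral_powR_Lnorm// -!EFinM -!EFinD lee_fin; apply.
  - by rewrite mulr_ge0 ?powR_ge0.
  - by rewrite !mulr_ge0 ?powR_ge0.
  - exact: powR_ge0.
  - exact: powR_ge0.
  - by apply: mpow; exact: measurable_funD.
  - by apply: mpow; exact: measurable_funB.
  - exact: mpow.
  - exact: mpow.
  - by move=> x; exact: powR_ge0.
  - by move=> x; exact: powR_ge0.
  - by move=> x; exact: powR_ge0.
  - by move=> x; exact: powR_ge0.
  move=> x; set u := f x + g x; set v := f x - g x.
  have -> : 2 `^ p * `|f x| `^ p = `|u + v| `^ p.
    rewrite -powRM// -[X in X * _]ger0_norm// -normrM.
    by congr (`|_| `^ _); rewrite /u /v; ring.
  have -> : 2 `^ p * `|g x| `^ p = `|u - v| `^ p.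
    rewrite -powRM// -[X in X * _]ger0_norm// -normrM.
    by congr (`|_| `^ _); rewrite /u /v; ring.
  apply: le_trans (two_point_inequality u v p12).
  rewrite -!mulrA -mulrDr ler_pM2l// -!sqr_powR_half.
  rewrite -(powRM _ p10 (sqr_ge0 v)).
  apply: powRD_ge_weighted => //; first exact: sqr_ge0.
  by rewrite mulr_ge0 ?sqr_ge0.
set N := S ^+ 2 + _.
have N0 : 0 <= N by rewrite addr_ge0 ?mulr_ge0 ?sqr_ge0.
have [NE|NE] := eqVneq N 0.
  rewrite NE powR0; last lra.
  by rewrite mulr0 addr_ge0 ?mulr_ge0 ?powR_ge0.
(* The weights that make the reverse Minkowski inequality an equality. *)
pose s := S ^+ 2 / N; pose t := (p - 1) * D ^+ 2 / N.
have s0 : 0 <= s by rewrite divr_ge0 ?sqr_ge0.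
have t0 : 0 <= t by rewrite divr_ge0 ?mulr_ge0 ?sqr_ge0.
have st : s + t = 1 by rewrite -mulrDl divff.
apply: le_trans (weighted s t s0 t0 st).
have sP z : z `^ (1 - p / 2) * z `^ (p / 2) = z `^ 1.
  by rewrite -powRD ?subrK ?oner_eq0.
rewrite -{1}(ger0_norm S0) -{1}(ger0_norm D0) -!sqr_powR_half.
rewrite -!mulrA -mulrDr ler_pM2l// -(powRM _ p10 (sqr_ge0 D)).
have -> : S ^+ 2 = s * N by rewrite divfK.
have -> : (p - 1) * D ^+ 2 = t * N by rewrite divfK.
rewrite (powRM _ s0 N0) (powRM _ t0 N0) !mulrA !sP !powRr1//.
by rewrite -mulrDl st mul1r.
Qed.

Lemma Lnorm_uniform_convexity p r f g : 1 < p < 2 -> 0 <= r ->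
    measurable_fun setT f -> measurable_fun setT g ->
    ('N_p[f] <= r%:E)%E -> ('N_p[g] <= r%:E)%E ->
  fine 'N_p[(f \+ g)%R] ^+ 2 + (p - 1) * fine 'N_p[(f \- g)%R] ^+ 2 <=
  (2 * r) ^+ 2.
Proof.
move=> p12 r0 mf mg fr gr; have /andP[p1 p2] := p12.
have foo : ('N_p[f] < +oo)%E by apply: le_lt_trans fr _; rewrite ltry.
have goo : ('N_p[g] < +oo)%E by apply: le_lt_trans gr _; rewrite ltry.
have := Lnorm_parallelogram p12 mf mg foo goo.
set N := _ ^+ 2 + _ => NE.
have N0 : 0 <= N.
  by rewrite /N addr_ge0 ?sqr_ge0// mulr_ge0 ?sqr_ge0// subr_ge0 ltW.
have le_r h : ('N_p[h] <= r%:E)%E -> 2 `^ p * fine 'N_p[h] `^ p <= (2 * r) `^ p.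
  move=> hr; rewrite powRM// ler_pM2l ?powR_gt0//.
  have h0 := Lnorm_ge0 mu p%:E (EFin \o h).
  apply: ge0_ler_powR; rewrite ?nnegrE ?fine_ge0//; first lra.
  by rewrite -lee_fin fineK// ge0_fin_numE// (le_lt_trans hr)// ltry.
(* The exponent [p / 2] is removed by strict monotonicity: a larger [N] would give [N]^ (p / 2) > (2
   * r) [^ p], against the bound just obtained. *)
rewrite leNgt; apply/negP => rN.
have : ((2 * r) ^+ 2) `^ (p / 2) < N `^ (p / 2).
  by apply: gt0_ltr_powR; rewrite ?nnegrE ?sqr_ge0//; lra.
rewrite sqr_powR_half ger0_norm ?mulr_ge0//.
have := le_r f fr; have := le_r g gr; lra.
Qed.

End Lp_uniform_convexity.

(** * Transfer to the ratios that define the grand Lebesgue norm *)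

Section grand_Lebesgue_norm.
Local Set Implicit Arguments.
Local Unset Strict Implicit.
Local Open Scope ereal_scope.
Context d (T : measurableType d) (R : realType).
Variables (mu : {measure set T -> \bar R}) (psi : R -> \bar R).

Lemma Gratio_ge0 (f : T -> R) (p : R) :
  0 <= psi p -> 0 <= Gratio mu psi f p.
Proof.
rewrite /Gratio; case: (psi p) => [r| |]// r0.
by rewrite mule_ge0// ?Lnorm_ge0// lee_fin invr_ge0 -lee_fin.
Qed.

Lemma GLball_Lnorm_le (a b p r : R) (f : T -> R) :
  GLball mu psi a b f -> (a < p < b)%R -> psi p = r%:E -> (0 < r)%R ->
  Lnorm mu p%:E (EFin \o f) <= r%:E.
Proof.
move=> [_ f1] pab psip r0.
have : Gratio mu psi f p <= 1.
  by apply: le_trans f1; apply: ereal_sup_ubound; exists p; rewrite /= ?in_itv.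
by rewrite /Gratio psip lee_pdivrMr// mul1e.
Qed.

(** Real witnesses for both ratios leave only real arithmetic for the final estimate. The bound is
    uniform convexity with radius [r = psi p], divided by [r ^+ 2]. *)
Lemma Gratio_uniform_convexity (a b p : R) (x y : T -> R) :
  GLball mu psi a b x -> GLball mu psi a b y -> (1 < p < 2)%R ->
  (a < p < b)%R -> 0 < psi p ->
  exists2 sd : R * R, Gratio mu psi (x \+ y)%R p = sd.1%:E /\
                      Gratio mu psi (x \- y)%R p = sd.2%:E &
    (sd.1 + (p - 1) / 4 * sd.2 ^+ 2 <= 2)%R.
Proof.
move=> Bx By p12 pab psi0.
(* If [psi p] is infinite, both ratios are 0 by convention. *)
have [psiE|] := boolP (psi p \is a fin_num); last first.
  rewrite ge0_fin_numE ?(ltW psi0)// -leNgt leye_eq => /eqP psiE.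
  exists (0, 0)%R; first by rewrite /Gratio psiE.
  by rewrite /= expr0n mulr0 addr0.
have {psiE} [r psiE] : exists r, psi p = r%:E.
  by exists (fine (psi p)); rewrite fineK.
have r0 : (0 < r)%R by rewrite -lte_fin -psiE.
have [mx my] : measurable_fun setT x /\ measurable_fun setT y.
  by move: Bx By => [[? _] _] [[? _] _].
have Nx := GLball_Lnorm_le Bx pab psiE r0.
have Ny := GLball_Lnorm_le By pab psiE r0.
have := Lnorm_uniform_convexity p12 (ltW r0) mx my Nx Ny.
have xoo := le_lt_trans Nx (ltry r); have yoo := le_lt_trans Ny (ltry r).
have p1 : (1 <= p)%R by have /andP[/ltW] := p12.
have Soo := LnormD_lty p1 mx my xoo yoo.
have Doo := LnormB_lty p1 mx my xoo yoo.
rewrite /Gratio psiE.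
rewrite -[Lnorm mu _ (EFin \o (x \+ y)%R)]fineK ?ge0_fin_numE ?Lnorm_ge0//.
rewrite -[Lnorm mu _ (EFin \o (x \- y)%R)]fineK ?ge0_fin_numE ?Lnorm_ge0//=.
move: (fine _) (fine _) => D S SD; exists (S / r, D / r)%R => //=.
have SE : S = (S / r * r)%R by rewrite divfK ?gt_eqF.
have DE : D = (D / r * r)%R by rewrite divfK ?gt_eqF.
move: SD; rewrite {1}SE {1}DE; move: (S / r)%R (D / r)%R => s e.
rewrite !exprMn [((p - 1) * _)%R]mulrA -mulrDl ler_pM2r ?exprn_gt0// => se.
by move: se (sqr_ge0 (s - 2)%R); clear; lra.
Qed.

End grand_Lebesgue_norm.

Local Open Scope ereal_scope.

Theorem theorem2p1 (d : measure_display) (T : measurableType d) (R : realType)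
  (mu : {measure set T -> \bar R})
  (Hnontriv : 0 < mu [set: T]) (Hatomless : atomless mu)
  (a b : R) (Ha : (1 < a)%R) (Hab : (a < b)%R) (Hb : (b <= 2)%R)
  (psi : R -> \bar R)
  (Hpsi_pos : forall p : R, (a < p < b)%R -> 0 < psi p)
  (Hpsi_inf : 0 < ereal_inf [set psi p | p in `]a, b[%classic])
  (x y : T -> R) (Hx : GLball mu psi a b x) (Hy : GLball mu psi a b y) :
  GLnorm mu psi a b (x \+ y)%R
    <= 2%:E - ((a - 1) / 4)%:E * Gkappa mu psi a b (x \- y)%R.
Proof.
apply: ge_ereal_sup => _ [p + <-]; rewrite /= in_itv/= => pab.
have /andP[ap pb] := pab.
(* The interval is open at [b], so [p < 2] holds even when [b = 2]. *)
have p12 : (1 < p < 2)%R by rewrite (lt_trans Ha ap) (lt_le_trans pb Hb).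
have [[s e]/= [-> eE] se] :=
  Gratio_uniform_convexity Hx Hy p12 pab (Hpsi_pos _ pab).
have k0 : 0 <= Gkappa mu psi a b (x \- y)%R.
  apply: le_ereal_inf_tmp => _ [q + <-]; rewrite /= in_itv/= => /Hpsi_pos q0.
  by rewrite mule_ge0// Gratio_ge0// ltW.
have ke : Gkappa mu psi a b (x \- y)%R <= (e * e)%:E.
  by apply: ereal_inf_lbound; exists p; rewrite /= ?in_itv// eE.
(* The two bounds make the infimum a real [k] with [0 <= k <= e * e]; with [1 < a < p] this gives
   [(a - 1) * k <= (p - 1) * e ^+ 2]. *)
move: (Gkappa _ _ _ _ _) k0 ke => [k| |]//; rewrite !lee_fin => k0 ke.
by move: Ha ap se k0 ke; clear; nra.
Qed.
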